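(* Let $n>2$ be an integer. If $G$ is a group with $\Gamma_G\cong\Gamma_{D_{2n}}$, then $|G|=2n$ and $G$ contains a cyclic subgroup of order $n$. In particular, if $n$ is odd, then $G\cong D_{2n}$.
   Context: A group is locally cyclic if each of its finitely generated subgroups is cyclic. For a group $G$, $Cyc(G)=\{x\in G : \langle x,y\rangle \text{ is cyclic for all } y\in G\}$. For a non locally cyclic group $G$, the non-cyclic graph $\Gamma_G$ is the simple graph with vertex set $G\setminus Cyc(G)$ in which two distinct vertices $x,y$ are adjacent if and only if $\langle x,y\rangle$ is not cyclic. $\Gamma_G\cong\Gamma_K$ means that $G$ and $K$ are non locally cyclic groups and the two graphs are isomorphic ($G$ is not assumed finite). $D_{2n}$ is the dihedral group of order $2n$. *)

(* Defs.v *)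
From mathcomp Require Import all_boot all_fingroup all_solvable.
From mathcomp Require Import boolp classical_sets cardinality.

Set Implicit Arguments.
Unset Strict Implicit.
Unset Printing Implicit Defensive.

Local Open Scope classical_set_scope.
Local Open Scope group_scope.

(* Groups are [groupType]s, which may be infinite; subsets of a group are     *)
(* classical [set]s, as fingroup's <<A>> and [cyclic] only cover finite ones.   *)
Section Subgroups.
Variable G : groupType.
Implicit Types A H : set G.

Definition sgen A : set G :=
  smallest [set H : set G | group_closed [in H]] A.

Definition cyclic_subgroup H := exists x : G, H = sgen [set x].

Definition locally_cyclic :=
  forall A, finite_set A -> cyclic_subgroup (sgen A).

Definition Cyc : set G :=
  [set x | forall y, cyclic_subgroup (sgen [set x; y])].

End Subgroups.

Arguments locally_cyclic : clear implicits.
Arguments Cyc : clear implicits.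

Record sgraph := SGraph {
  vertex :> Type;
  adj : vertex -> vertex -> Prop;
  adj_sym : forall u v, adj u v -> adj v u;
  adj_irrefl : forall u, ~ adj u u
}.

Definition sgraph_iso (X Y : sgraph) :=
  exists2 f : X -> Y, bijective f & forall u v, adj (f u) (f v) <-> adj u v.

Section NonCyclicGraph.
Variable G : groupType.

Definition noncyclic_adj (u v : ~` Cyc G) :=
  u <> v /\ ~ cyclic_subgroup (sgen [set val u; val v]).

Lemma noncyclic_adj_sym u v : noncyclic_adj u v -> noncyclic_adj v u.
Proof. by move=> [uv ncuv]; split; [exact/nesym|rewrite setUC]. Qed.

Lemma noncyclic_adj_irrefl u : ~ noncyclic_adj u u.
Proof. by case. Qed.

Definition noncyclic_graph :=
  SGraph noncyclic_adj_sym noncyclic_adj_irrefl.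

End NonCyclicGraph.

(* The non-cyclic graph is only considered for groups that are not locally    *)
(* cyclic, so this is part of the meaning of an isomorphism of such graphs.   *)
Definition noncyclic_graph_iso (G K : groupType) :=
  [/\ ~ locally_cyclic G, ~ locally_cyclic K
    & sgraph_iso (noncyclic_graph G) (noncyclic_graph K)].

Definition group_iso (G K : groupType) :=
  exists f : {multiplicative G -> K}, bijective f.

(* Main.v *)
(* In the dihedral group the rotations pairwise generate cyclic groups, while *)
(* a reflection is joined to every other vertex, so the graph is a clique of  *)
(* n reflections joined to n - 1 independent rotations. Let v be a vertex of  *)
(* the graph of G that is joined to all others. For c in Cyc(G), v c is a     *)
(* vertex not joined to v, so c = 1 and Cyc(G) is trivial; moreover v^-1 is   *)
(* not joined to v, so v is an involution. Let A consist of 1 and of the      *)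
(* vertices matching the rotations. If some nontrivial a in A and b lie in a  *)
(* common cyclic group then b is in A, which makes A a cyclic subgroup of     *)
(* order n. All elements outside A are involutions, so they invert A and, as  *)
(* n > 2, A has index 2. Hence G is dihedral, whatever the parity of n.       *)

Require Import Defs.
From HB Require Import structures.
From mathcomp Require Import all_boot all_fingroup all_solvable.
From mathcomp Require Import boolp classical_sets cardinality.

Local Open Scope classical_set_scope.
Local Open Scope card_scope.
Local Open Scope group_scope.

Set Implicit Arguments.
Unset Strict Implicit.
Unset Printing Implicit Defensive.

(** The graph records which pairs of vertices lie in a common cyclic subgroup ([cycP]). A reflection
    shares one only with 1 and itself ([dihedral_cyc_refl]); this forces [Cyc G] to be trivial
    ([Cyc_trivial]), and the graph isomorphism, extended by 1 to 1, becomes a bijection of groups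
    preserving [cyc] ([noncyclic_graph_iso_cyc]). The relation then recovers the group: the preimage
    [A] of the rotations is cyclic of order [n] ([A_cyclic]), its complement consists of involutions
    inverting [A], and so [A] has index 2. The resulting dihedral generators
    ([dihedral_gens_transfer]) yield the order, the cyclic subgroup and the isomorphism
    ([dihedral_gens_iso]). *)

(** * Generated subgroups and pairs with a common cyclic overgroup *)

Section CyclicPairs.
Variable G : groupType.
Implicit Types (A H : set G) (g h w x y z : G).

Lemma sgen1 A : sgen A 1.
Proof. by move=> H [[+ _] _]; rewrite inE. Qed.

Lemma sgen_div A g h : sgen A g -> sgen A h -> sgen A (g * h^-1).
Proof.
move=> Ag Ah H HA; have [[_ +] _] := HA; move=> /(_ g h).
by rewrite !inE; apply; [exact: Ag|exact: Ah].
Qed.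

Lemma sgenV A g : sgen A g -> sgen A g^-1.
Proof.
by move=> Ag; rewrite -[_^-1]mul1g; apply: sgen_div => //; exact: sgen1.
Qed.

Lemma sgenVE A g : sgen A g^-1 <-> sgen A g.
Proof. by split=> /sgenV //; rewrite invgK. Qed.

Lemma sgenM A g h : sgen A g -> sgen A h -> sgen A (g * h).
Proof. by move=> Ag /sgenV Ah; rewrite -[h]invgK; apply: sgen_div. Qed.

Lemma sgenX A g k : sgen A g -> sgen A (g ^+ k).
Proof.
move=> Ag; elim: k => [|k IH]; first exact: sgen1.
by rewrite expgS; apply: sgenM.
Qed.

Lemma sgen_in A g : A g -> sgen A g.
Proof. by move=> Ag H [_]; apply. Qed.

Lemma sgen_sub A H : H 1 -> (forall g h, H g -> H h -> H (g * h^-1)) ->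
  A `<=` H -> sgen A `<=` H.
Proof.
move=> H1 HB; apply: smallest_sub; split; first by rewrite inE.
by move=> g h; rewrite !inE; apply: HB.
Qed.

Lemma sgen_subl A B : A `<=` sgen B -> sgen A `<=` sgen B.
Proof. by apply: sgen_sub; [exact: sgen1|exact: sgen_div]. Qed.

Lemma sgen1P x g : sgen [set x] g <-> exists k, g = x ^+ k \/ g = x ^- k.
Proof.
split; last first.
  by case=> k [] ->; [|apply: sgenV]; apply: sgenX; apply: sgen_in.
move: g; apply: sgen_sub.
- by exists 0%N; left.
- have cc i j : x ^- i * x ^+ j = x ^+ j * x ^- i.
    by apply/esym/commuteV/commuteX2.
  have sub i j : exists k, x ^+ i * x ^- j = x ^+ k \/ x ^+ i * x ^- j = x ^- k.
    have [ij|/ltnW ij] := leqP j i.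
      by exists (i - j)%N; left; rewrite expgnFr.
    by exists (j - i)%N; right; rewrite expgnFr // invgF.
  move=> _ _ [i [] ->] [j [] ->].
  + exact: sub.
  + by exists (i + j)%N; left; rewrite invgK expgnDr.
  + by exists (j + i)%N; right; rewrite expgnDr invgM.
  + by rewrite invgK cc; apply: sub.
- by move=> _ ->; exists 1%N; left.
Qed.

Definition cyc x y := cyclic_subgroup (sgen [set x; y]).

Lemma cycC x y : cyc x y -> cyc y x.
Proof. by rewrite /cyc setUC. Qed.

(** Take [z] to be [w] to the gcd of [i] and [j], which Bezout writes as a quotient of powers of the
    two elements. *)
Lemma sgen_bezout w i j : exists z, [/\ sgen [set w ^+ i; w ^+ j] z,
  sgen [set z] (w ^+ i) & sgen [set z] (w ^+ j)].
Proof.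
case: i => [|i].
  by exists (w ^+ j); split; [apply: sgen_in; right|apply: sgen1|apply: sgen_in].
have [ki kj e _] := egcdnP j (ltn0Sn i).
have {}e : w ^+ gcdn i.+1 j = (w ^+ i.+1) ^+ ki * (w ^+ j) ^- kj.
  by rewrite -!expgnA mulnC e mulnC addnC expgnDr mulgK.
exists (w ^+ gcdn i.+1 j); split.
- by rewrite e; apply: sgen_div; apply: sgenX; apply: sgen_in; [left|right].
- rewrite -{2}(divnK (dvdn_gcdl i.+1 j)) mulnC expgnA.
  by apply: sgenX; apply: sgen_in.
- rewrite -{2}(divnK (dvdn_gcdr i.+1 j)) mulnC expgnA.
  by apply: sgenX; apply: sgen_in.
Qed.

(** A two-generated subgroup of a cyclic group is cyclic by [sgen_bezout]; the signs of the
    exponents do not change the subgroup. *)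
Lemma cycP x y : cyc x y <-> exists w, sgen [set w] x /\ sgen [set w] y.
Proof.
split=> [[w e]|[w [/sgen1P[i xi] /sgen1P[j yj]]]].
  by exists w; split; rewrite -e; apply: sgen_in; [left|right].
have [z [zij zi zj]] := sgen_bezout w i j.
have sgenX_of A g k : sgen A g -> g = w ^+ k \/ g = w ^- k -> sgen A (w ^+ k).
  by move=> Ag [<- //|gV]; apply/sgenVE; rewrite -gV.
exists z; apply/seteqP; split; apply: sgen_subl.
  by move=> _ [] ->; [case: xi|case: yj] => ->; rewrite ?sgenVE.
move=> _ ->; move: z zij {zi zj}; apply: sgen_subl => _ [] ->.
  by apply: (sgenX_of _ x) => //; apply: sgen_in; left.
by apply: (sgenX_of _ y) => //; apply: sgen_in; right.
Qed.

Lemma cyc1 x : cyc x 1.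
Proof. by apply/cycP; exists x; split; [apply: sgen_in|apply: sgen1]. Qed.

Lemma cycxx x : cyc x x.
Proof. by apply/cycP; exists x; split; apply: sgen_in. Qed.

Lemma cycV x : cyc x x^-1.
Proof. by apply/cycP; exists x; split; [|apply: sgenV]; apply: sgen_in. Qed.

Lemma Cyc1 : Cyc G 1.
Proof. by move=> y; apply/cycC/cyc1. Qed.

(* If c is in Cyc then every cyclic overgroup of <v c, y> sits, together with *)
(* c, in a single cyclic group, which then contains v and y.                  *)
Lemma Cyc_mulr v c : Cyc G c -> Cyc G (v * c) -> Cyc G v.
Proof.
move=> Cc Cvc y; have /cycP[w [wvc wy]] := Cvc y.
have /cycP[u [uc uw]] := Cc w.
have uS : sgen [set w] `<=` sgen [set u] by apply: sgen_subl => _ ->.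
apply/cycP; exists u; split; last exact: uS.
by rewrite -(mulgK c v); apply: sgen_div => //; apply: uS.
Qed.

Lemma Cyc_trivial v : ~ Cyc G v ->
  (forall g, cyc v g -> ~ Cyc G g -> g = v) -> Cyc G = [set 1].
Proof.
move=> NCv fullv; apply/seteqP; split=> [c Cc|_ ->]; last exact: Cyc1.
apply: (@mulgI _ v); rewrite mulg1; apply: fullv.
  have /cycP[w [wc wv]] := Cc v.
  by apply/cycP; exists w; split=> //; apply: sgenM.
by move=> /(Cyc_mulr Cc).
Qed.

Lemma expg_mod_order x n k : x ^+ n = 1 -> x ^+ (k %% n) = x ^+ k.
Proof.
by move=> xn; rewrite {2}(divn_eq k n) expgnDr mulnC expgnA xn expg1n mul1g.
Qed.

Lemma finite_sgen1 x : finite_set (sgen [set x]) ->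
  exists2 n, x ^+ n = 1 & [/\ 0 < n, sgen [set x] `<=` [set x ^+ i | i in `I_n]
    & {in `I_n &, injective (fun i => x ^+ i)}].
Proof.
move=> finx.
have eqX i j : i < j -> x ^+ i = x ^+ j -> (0 < j - i) && (x ^+ (j - i) == 1).
  by move=> ltij e; rewrite subn_gt0 ltij expgnFr ?(ltnW ltij) // e mulgV eqxx.
have exn : exists n, (0 < n) && (x ^+ n == 1).
  (* With no positive period, the powers of [x] would embed [nat] in a finite set. *)
  apply: contrapT => nex; apply: infinite_nat.
  have inj : {in [set: nat] &, injective (fun i => x ^+ i)}.
    move=> i j _ _ e; case: (ltngtP i j) => // [/eqX/(_ e)|/eqX/(_ (esym e))] ?;
      by case: nex; eexists; eassumption.
  rewrite -(eq_finite_set (inj_card_eq inj)).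
  by apply: sub_finite_set finx => _ [i _ <-]; apply: sgenX; apply: sgen_in.
have [n /andP[n_gt0 /eqP xn] nmin] := ex_minnP exn.
exists n => //; split=> //.
  move=> g /sgen1P[k [->|->]].
    by exists (k %% n); [exact: ltn_pmod|exact: expg_mod_order].
  (* A nonnegative exponent congruent to [- k] modulo [n]. *)
  exists ((n * k - k) %% n); first exact: ltn_pmod.
  by rewrite expg_mod_order // expgnFr ?leq_pmull // expgnA xn expg1n mul1g.
move=> i j; rewrite !inE /= => ltin ltjn e.
case: (ltngtP i j) => // [/eqX/(_ e)|/eqX/(_ (esym e))] /nmin.
  by rewrite leqNgt (leq_ltn_trans (leq_subr _ _) ltjn).
by rewrite leqNgt (leq_ltn_trans (leq_subr _ _) ltin).
Qed.

End CyclicPairs.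

(** * Dihedral groups through normal forms *)

Lemma card_eq_fintype (T : finType) : [set: T] #= `I_#|T|.
Proof.
pose f (t : T) : nat := enum_rank t.
have inj : {in [set: T] &, injective f} by move=> s t _ _ /ord_inj/enum_rank_inj.
rewrite -(card_eql (inj_card_eq inj)); suff -> : f @` setT = `I_#|T| by [].
apply/seteqP; split=> [_ [t _ <-]|i ltiT]; first exact: ltn_ord.
by exists (enum_val (Ordinal ltiT)); rewrite /f ?enum_valK.
Qed.

(** Unique normal forms stand in for a presentation, so that possibly infinite groups can be treated
    like ['D_(2 * n)]. *)
Record dihedral_gens (K : groupType) n (x y : K) : Prop := DihedralGens {
  dihedral_x : x ^+ n = 1;
  dihedral_y : y * y = 1;
  dihedral_xy : y * x = x^-1 * y;
  dihedral_bij : bijective (fun p : 'I_n * bool => x ^+ p.1 * y ^+ p.2)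
}.

Section DihedralGens.
Variables (K : groupType) (n : nat) (x y : K) (n_gt0 : 0 < n).
Hypothesis (xyP : dihedral_gens n x y).
Implicit Types g h : K.

Let R := sgen [set x].

Lemma dihedral_inj (i j : 'I_n) (b c : bool) :
  x ^+ i * y ^+ b = x ^+ j * y ^+ c -> (i, b) = (j, c).
Proof. by have [_ _ _ /bij_inj inj] := xyP; apply: (inj (i, b) (j, c)). Qed.

Lemma dihedral_mod k : exists i : 'I_n, x ^+ k = x ^+ i.
Proof.
have [xn _ _ _] := xyP.
by exists (Ordinal (ltn_pmod k n_gt0)); rewrite /= expg_mod_order.
Qed.

Lemma dihedral_yX k : y * x ^+ k = x ^- k * y.
Proof.
have [_ _ yx _] := xyP; elim: k => [|k IH]; first by rewrite invg1 mulg1 mul1g.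
by rewrite expgSr mulgA IH -mulgA yx mulgA -invgM -expgS expgSr.
Qed.

(** The multiplication table on normal forms depends on [n] alone; [n.-1 * j] represents [- j]
    modulo [n]. *)
Lemma dihedral_mul i j (b c : bool) :
  (x ^+ i * y ^+ b) * (x ^+ j * y ^+ c) =
  x ^+ (i + (if b then (n.-1 * j)%N else j)) * y ^+ (b (+) c).
Proof.
have [xn yy _ _] := xyP.
have xV : x ^- j = x ^+ (n.-1 * j)%N.
  apply: (@mulgI _ (x ^+ j)).
  by rewrite mulgV -expgnDr -mulSn prednK // expgnA xn expg1n.
case: b => /=; last by rewrite mulg1 expgnDr mulgA.
rewrite -mulgA [y * _]mulgA dihedral_yX xV expgnDr !mulgA -mulgA; congr (_ * _).
by case: c; rewrite ?mulg1.
Qed.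

Lemma dihedral_cases g : R g \/ exists i : 'I_n, g = x ^+ i * y.
Proof.
have [_ _ _ [f _ fK]] := xyP; rewrite -(fK g); case: (f g) => i [] /=.
  by right; exists i.
by left; rewrite mulg1; apply: sgenX; apply: sgen_in.
Qed.

Lemma dihedral_rot g : R g -> exists i : 'I_n, g = x ^+ i.
Proof.
have [xn _ _ _] := xyP => /sgen1P[k [->|->]]; first exact: dihedral_mod.
suff -> : x ^- k = x ^+ (n * k - k)%N by apply: dihedral_mod.
by rewrite expgnFr ?leq_pmull // expgnA xn expg1n mul1g.
Qed.

Lemma dihedral_rotE : R = [set x ^+ i | i in `I_n].
Proof.
apply/seteqP; split=> [g /dihedral_rot[i ->]|_ [i _ <-]]; first by exists i => /=.
by apply: sgenX; apply: sgen_in.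
Qed.

Lemma card_dihedral_rot : R #= `I_n.
Proof.
rewrite dihedral_rotE; apply: inj_card_eq => i j; rewrite !inE /= => ltin ltjn e.
have /= := @dihedral_inj (Ordinal ltin) (Ordinal ltjn) false false.
by rewrite e => /(_ erefl)[].
Qed.

Lemma dihedral_refl_notin i : ~ R (x ^+ i * y).
Proof.
have [k ->] := dihedral_mod i; move=> /dihedral_rot[j e].
by have /= := @dihedral_inj k j true false; rewrite e mulg1 => /(_ erefl)[].
Qed.

Lemma dihedral_refl_sqr g : ~ R g -> g * g = 1.
Proof.
have [xn _ _ _] := xyP; have [//|[i -> _]] := dihedral_cases g.
have /= := dihedral_mul i i true true; rewrite mulg1 => ->.
by rewrite -mulSn prednK // expgnA xn expg1n.
Qed.

(** A common generator [w] is no rotation, as [g] is none; hence it is an involution and generates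
    only 1 and [w]. *)
Lemma dihedral_cyc_refl g h : ~ R g -> cyc g h -> h = 1 \/ h = g.
Proof.
move=> NRg /cycP[w [wg wh]].
have NRw : ~ R w by move=> Rw; apply: NRg; move: g wg; apply: sgen_subl => _ ->.
have wP k : w ^+ k = 1 \/ w ^+ k = w.
  elim: k => [|k [IH|IH]]; [by left|right|left].
    by rewrite expgS IH mulg1.
  by rewrite expgS IH dihedral_refl_sqr.
have wV : w^-1 = w by apply/mulg1_eq/dihedral_refl_sqr.
have {}wP u : sgen [set w] u -> u = 1 \/ u = w.
  by case/sgen1P=> k [] ->; case: (wP k) => ->; rewrite ?invg1 ?wV; auto.
have [g1|->] := wP _ wg; last exact: wP.
by case: NRg; rewrite g1; apply: sgen1.
Qed.

(** A nontrivial rotation is excluded by pairing it with [y], a reflection by pairing it with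
    [x]. *)
Lemma Cyc_dihedral : 1 < n -> Cyc K = [set 1].
Proof.
move=> n_gt1; apply/seteqP; split=> [g Cg|_ ->]; last exact: Cyc1.
have NRy : ~ R y by rewrite -[y]mul1g; apply: (@dihedral_refl_notin 0).
have Rx : R x by apply: sgen_in.
apply: contrapT => g1.
have [Rg|NRg] := pselect (R g).
  have [//|gy] := dihedral_cyc_refl NRy (cycC (Cg y)).
  by apply: NRy; rewrite -gy.
have [x1|xg] := dihedral_cyc_refl NRg (Cg x); last by apply: NRg; rewrite -xg.
have /= := @dihedral_inj (Ordinal n_gt0) (Ordinal n_gt1) false false.
by rewrite x1 => /(_ erefl)[].
Qed.

Lemma card_dihedral_gens : [set: K] #= `I_(2 * n).
Proof.
have [_ _ _ bij] := xyP.
have -> : (2 * n)%N = #|{: 'I_n * bool}|.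
  by rewrite card_prod card_ord card_bool mulnC.
apply: card_eq_trans (card_eq_fintype _).
have inj := bij_inj bij; have [f _ fK] := bij.
suff -> : [set: K] = (fun p : 'I_n * bool => x ^+ p.1 * y ^+ p.2) @` setT.
  by apply: inj_card_eq => p q _ _ /inj.
by apply/seteqP; split=> // g _; exists (f g); rewrite ?fK.
Qed.

End DihedralGens.

Lemma dihedral_gens_iso (K L : groupType) n (x y : K) (u v : L) : 0 < n ->
  dihedral_gens n x y -> dihedral_gens n u v -> group_iso K L.
Proof.
move=> n_gt0 xyP uvP; have [_ _ _ [f hK fK]] := xyP.
have [_ _ _ bij] := uvP.
pose h (p : 'I_n * bool) := u ^+ p.1 * v ^+ p.2.
have fM : {morph h \o f : g1 g2 / g1 * g2}.
  move=> g1 g2; rewrite /= -{1}(fK g1) -{1}(fK g2) /h.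
  case: (f g1) (f g2) => [i b] [j c].
  rewrite (dihedral_mul n_gt0 xyP) (dihedral_mul n_gt0 uvP) /=.
  set k := (i + _)%N; have [xn _ _ _] := xyP; have [un _ _ _] := uvP.
  rewrite -(expg_mod_order k xn) -(expg_mod_order k un).
  by have /= -> := hK (Ordinal (ltn_pmod k n_gt0), b (+) c).
exists (HB.pack_for {multiplicative K -> L} (h \o f)
  (isMultiplicative.Build _ _ _ fM)).
by apply: bij_comp bij _; exact: (Bijective fK hK).
Qed.

Lemma dihedral_gens_D n : 1 < n ->
  exists x y : 'D_(2 * n), dihedral_gens n x y.
Proof.
move=> n_gt1; have := Grp_dihedral n_gt1; rewrite -mul2n.
move=> /isoGrp_hom/existsP[[x y]] /= /eqP[defG xn y2 xy].
pose f (p : 'I_n * bool) := x ^+ p.1 * y ^+ p.2.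
have D g : exists p, f p == g.
  have: g \in <[x]> * <[y]>.
    rewrite -norm_joinEr ?defG ?inE // cycle_subG; apply/normP.
    by rewrite -cycleJ xy cycleV.
  case/mulsgP=> _ _ /cycleP[i ->] /cycleP[j ->] ->.
  exists (Ordinal (ltn_pmod i (ltnW n_gt1)), odd j).
  by rewrite /f /= -modn2 !expg_mod.
exists x, y; split=> //.
  by rewrite [RHS]conjgC conjVg xy invgK.
(* A section of the surjection [f] is injective, hence bijective by cardinality. *)
pose s g := xchoose (D g).
have sK : cancel s f by move=> g; apply/eqP/(xchooseP (D g)).
apply: (bij_can_bij _ sK); apply: inj_card_bij; first exact: can_inj sK.
rewrite -[X in _ <= X]cardsT mul2n card_dihedral //.
by rewrite card_prod card_ord card_bool muln2.
Qed.

(** * From graph isomorphisms to bijections of groups *)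

Section VertexExtension.
Variables G K : groupType.
Implicit Types f : noncyclic_graph G -> noncyclic_graph K.

Definition vertex_ext f (g : G) : K :=
  if pselect ((~` Cyc G) g) is left NCg then val (f (exist _ g (mem_set NCg)))
  else 1.

Lemma vertex_ext_val f u : vertex_ext f (val u) = val (f u).
Proof.
rewrite /vertex_ext; case: pselect => [NCu|[]]; last exact: set_valP.
by congr (val (f _)); apply: val_inj.
Qed.

Lemma vertex_ext1 f : vertex_ext f 1 = 1.
Proof. by rewrite /vertex_ext; case: pselect => // -[]; exact: Cyc1. Qed.

Lemma vertexP g : Cyc G = [set 1] ->
  g = 1 \/ exists u : noncyclic_graph G, g = val u.
Proof.
move=> C1; have [->|g1] := pselect (g = 1); first by left.
have NCg : (~` Cyc G) g by rewrite C1.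
by right; exists (exist _ g (mem_set NCg)).
Qed.

Lemma cyc_adj (u v : noncyclic_graph G) : cyc (val u) (val v) <-> ~ adj u v.
Proof.
split=> [cuv [] //|Nuv]; apply: contrapT => Ncuv; apply: Nuv; split=> // uv.
by apply: Ncuv; rewrite uv; apply: cycxx.
Qed.

End VertexExtension.

Lemma noncyclic_graph_iso_cyc (G K : groupType) :
  sgraph_iso (noncyclic_graph G) (noncyclic_graph K) ->
  Cyc G = [set 1] -> Cyc K = [set 1] ->
  exists f : G -> K, [/\ bijective f, f 1 = 1
    & forall g h, cyc (f g) (f h) <-> cyc g h].
Proof.
move=> [f [f' fK f'K] adjf] CG CK; exists (vertex_ext f); split.
- exists (vertex_ext f') => g.
    have [->|[u ->]] := vertexP g CG; first by rewrite !vertex_ext1.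
    by rewrite !vertex_ext_val fK.
  have [->|[u ->]] := vertexP g CK; first by rewrite !vertex_ext1.
  by rewrite !vertex_ext_val f'K.
- exact: vertex_ext1.
- move=> g h; have [->|[u ->]] := vertexP g CG.
    by rewrite vertex_ext1; split=> _; apply/cycC/cyc1.
  have [->|[v ->]] := vertexP h CG.
    by rewrite vertex_ext1; split=> _; apply: cyc1.
  by rewrite !vertex_ext_val; split=> /cyc_adj uv; apply/cyc_adj => /adjf.
Qed.

(** * Recovering the dihedral structure from the relation [cyc] *)

Section Transfer.
Variables (G K : groupType) (n : nat) (x y : K) (f : G -> K).
Hypotheses (n_gt2 : 2 < n) (xyP : dihedral_gens n x y).
Hypotheses (bijf : bijective f) (f1 : f 1 = 1).
Hypothesis cycf : forall g h, cyc (f g) (f h) <-> cyc g h.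

Let n_gt0 : 0 < n. Proof. exact: ltn_trans n_gt2. Qed.
Let A : set G := f @^-1` sgen [set x].

Let A1 : A 1. Proof. by rewrite /A /= f1; apply: sgen1. Qed.

Let cyc_notin g h : ~ A g -> cyc g h -> h = 1 \/ h = g.
Proof.
move=> NAg /cycf/(dihedral_cyc_refl n_gt0 xyP NAg)[|/(bij_inj bijf)]; last first.
  by right.
by rewrite -f1 => /(bij_inj bijf); left.
Qed.

(** Since [g] and [g^-1] share a cyclic group, [g^-1] is 1 or [g]. *)
Let sqr_notin g : ~ A g -> g * g = 1.
Proof.
move=> NAg; have [g1|gV] := cyc_notin NAg (cycV g); last by rewrite -{1}gV mulVg.
by rewrite -(invgK g) g1 invg1 mulg1.
Qed.

Let A_cyc g h : A g -> g <> 1 -> cyc g h -> A h.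
Proof.
move=> Ag g1 /cycC gh; apply: contrapT => NAh.
by have [|e] := cyc_notin NAh gh => //; apply: NAh; rewrite -e.
Qed.

Let card_A : A #= `I_n.
Proof.
apply: card_eq_trans (card_dihedral_rot n_gt0 xyP).
have -> : sgen [set x] = f @` A.
  have [f' _ f'K] := bijf.
  apply/seteqP; split=> [k Rk|_ [g Ag <-]] //.
  by exists (f' k); rewrite /A /= f'K.
by rewrite card_eq_sym; apply: inj_card_eq => g h _ _ /(bij_inj bijf).
Qed.

(* Two elements of A lie in a common cyclic subgroup, and that subgroup stays *)
(* in A, so a finite subset of A is caught by one generator in A.             *)
Let A_cyclic : exists c, A = sgen [set c].
Proof.
have gen (s : seq G) : (forall g, g \in s -> A g) ->
    exists2 c, A c & forall g, g \in s -> sgen [set c] g.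
  elim: s => [|b s IH] sA; first by exists 1.
  have [|c Ac sc] := IH; first by move=> g gs; apply: sA; rewrite inE gs orbT.
  have Ab : A b by apply: sA; rewrite inE eqxx.
  have [b1|b1] := pselect (b = 1).
    exists c => // g; rewrite inE => /predU1P[->|/sc//].
    by rewrite b1; apply: sgen1.
  (* The images of [b] and [c] are both powers of [x]. *)
  have /cycP[w [wb wc]] : cyc b c by apply/cycf/cycP; exists x.
  exists w.
    by apply: (A_cyc Ab b1); apply/cycP; exists w; split=> //; apply: sgen_in.
  by move=> g; rewrite inE => /predU1P[->//|/sc]; apply: sgen_subl => _ ->.
have /finite_seqP[s As] : finite_set A by exists n; exact: card_A.
have [|c Ac sc] := gen s; first by move=> g gs; rewrite As.
exists c; apply/seteqP; split=> [g|g cg]; first by rewrite {1}As => /sc.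
have [c1|c1] := pselect (c = 1).
  by case/sgen1P: cg => k [] ->; rewrite c1 expg1n ?invg1.
by apply: (A_cyc Ac c1); apply/cycP; exists c; split=> //; apply: sgen_in.
Qed.

Lemma dihedral_gens_transfer : exists c t : G, dihedral_gens n c t.
Proof.
have [c Ac] := A_cyclic.
have [d cd [d_gt0 dsur dinj]] : exists2 d, c ^+ d = 1 &
    [/\ 0 < d, sgen [set c] `<=` [set c ^+ i | i in `I_d]
    & {in `I_d &, injective (fun i => c ^+ i)}].
  by apply: finite_sgen1; rewrite -Ac; exists n; exact: card_A.
have dn : d = n.
  apply/card_eq_II; apply: card_eq_trans card_A; rewrite card_eq_sym.
  have -> : A = [set c ^+ i | i in `I_d].
    rewrite Ac; apply/seteqP; split=> // _ [i _ <-].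
    by apply: sgenX; apply: sgen_in.
  exact: inj_card_eq.
subst d.
have AX i : A (c ^+ i) by rewrite Ac; apply: sgenX; apply: sgen_in.
have AM g h : A g -> A h -> A (g * h) by rewrite Ac; apply: sgenM.
have AV g : A g -> A g^-1 by rewrite Ac; apply: sgenV.
(* Both [g] and [g * c] lie outside [A], so both are involutions. *)
have c_inv g : ~ A g -> g * c = c^-1 * g.
  move=> NAg; have NAgc : ~ A (g * c).
    by move=> /AM/(_ (AV _ (AX 1%N))); rewrite mulgK.
  have gV : g^-1 = g by apply/mulg1_eq/sqr_notin.
  by have /mulg1_eq := sqr_notin NAgc; rewrite invMg gV.
have cc : c * c <> 1.
  move=> cc; have /(dinj 2 0) : c ^+ 2 = c ^+ 0 by [].
  by rewrite !inE /= => /(_ n_gt2 n_gt0).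
(* If g h were outside A then conjugation by g, h and g h would all invert c. *)
have A_index2 g h : ~ A g -> ~ A h -> A (g * h).
  move=> NAg NAh; apply: contrapT => /c_inv.
  rewrite -mulgA (c_inv h) // mulgA.
  have -> : g * c^-1 = c * g.
    by apply: (canLR (mulgK c)); rewrite -mulgA c_inv // mulVKg.
  by rewrite -mulgA => /mulIg cV; apply: cc; rewrite {1}cV mulVg.
have [t NAt] : exists t, ~ A t.
  have [f' _ f'K] := bijf; exists (f' y); rewrite /A /= f'K.
  by rewrite -[y]mul1g; apply: (dihedral_refl_notin n_gt0 xyP (i := 0)).
exists c, t; split=> //; [exact: sqr_notin|exact: c_inv|].
pose h (p : 'I_n * bool) := c ^+ p.1 * t ^+ p.2.
have D g : exists p, h p == g.
  have D' k : A k -> exists i : 'I_n, c ^+ i = k.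
    by rewrite Ac => /dsur[i ltin <-]; exists (Ordinal ltin).
  have [/D'[i <-]|NAg] := pselect (A g).
    by exists (i, false); rewrite /h mulg1.
  (* Here [g * t] is a power of [c], and [t] is its own inverse. *)
  have [i e] := D' _ (A_index2 _ _ NAg NAt).
  by exists (i, true); rewrite /h /= e -mulgA sqr_notin // mulg1.
have hinj : injective h.
  have aux (i j : 'I_n) : c ^+ i * t <> c ^+ j.
    move=> /(canRL (mulKg _)) e; apply: NAt; rewrite e.
    by apply: AM => //; apply: AV.
  case=> i [] [j []]; rewrite /h /= ?mulg1.
  - move=> /mulIg/dinj; rewrite !inE /=.
    by move=> /(_ (ltn_ord _) (ltn_ord _))/val_inj ->.
  - by move=> /aux.
  - by move=> /esym/aux.
  - by move=> /dinj; rewrite !inE /= => /(_ (ltn_ord _) (ltn_ord _))/val_inj ->.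
pose s g := xchoose (D g).
have sK : cancel s h by move=> g; apply/eqP/(xchooseP (D g)).
by exists s => //; apply: inj_can_sym.
Qed.

End Transfer.

Theorem proposition8p4 (n : nat) (n_gt2 : (2 < n)%N) (G : groupType)
    (isoG : noncyclic_graph_iso G ('D_(2 * n))%type) :
  [/\ [set: G] #= `I_(2 * n),
      exists H : set G, cyclic_subgroup H /\ H #= `I_n
    & odd n -> group_iso G ('D_(2 * n))%type].
Proof.
have n_gt1 := ltnW n_gt2; have n_gt0 := ltnW n_gt1.
have [x [y xyP]] := dihedral_gens_D n_gt1.
have [_ _ iso] := isoG; have CD := Cyc_dihedral n_gt0 xyP n_gt1.
(* The vertex matching the reflection [y] is joined to all others, as [Cyc_trivial] requires. *)
have CG : Cyc G = [set 1].
  have [f [f' fK f'K] adjf] := iso.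
  have NRy : ~ sgen [set x] y.
    by rewrite -[y]mul1g; apply: (dihedral_refl_notin n_gt0 xyP (i := 0)).
  have [y1|[v yv]] := vertexP y CD; first by case: NRy; rewrite y1; apply: sgen1.
  apply: (@Cyc_trivial _ (val (f' v))); first exact: (set_valP (f' v)).
  move=> g vg NCg; pose u : noncyclic_graph G := exist _ g (mem_set NCg).
  have : cyc (val v) (val (f u)).
    by apply/cyc_adj; rewrite -[v]f'K => /adjf; exact: (cyc_adj (f' v) u).1 vg.
  rewrite -yv => /(dihedral_cyc_refl n_gt0 xyP NRy)[fu1|].
    by case: (set_valP (f u)); rewrite fu1; apply: Cyc1.
  by rewrite yv => /val_inj <-; rewrite fK.
have [f [bijf f1 cycf]] := noncyclic_graph_iso_cyc iso CG CD.
have [c [t ctP]] := dihedral_gens_transfer n_gt2 xyP bijf f1 cycf.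
split; first exact: card_dihedral_gens ctP.
  by exists (sgen [set c]); split; [exists c|exact: card_dihedral_rot ctP].
by move=> _; apply: dihedral_gens_iso ctP xyP.
Qed.
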